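(* Let $A=(a_1\ \cdots\ a_n)$ be a $1\times n$ matrix of positive integers with $n\ge2$ and $a_1<a_2$, which admits a gluing of the first kind in the order $(a_1,\dots,a_n)$. Let $M=\{u_2,\dots,u_n\}$ be a minimal Markov basis for $A$ with $u_k=(u_{k,1},u_{k,2},\dots,u_{k,k-1},-u_{k,k},0,\dots,0)$ for each $k$, where all $u_{k,m}$ are non-negative integers and $u_{k,k}>0$. Then the following are equivalent: (1) $M$ is distance reducing; (2) $M$ reduces the distance of the circuits of $A$; (3) $M$ satisfies condition $R_{i,j}$ for every $2\le i<j\le n$.
   Context: For $z\in\mathbb Z^n$, $z^+,z^-\in\mathbb N^n$ denote the unique vectors with disjoint supports and $z=z^+-z^-$; $\|\cdot\|$ is the $1$-norm. A Markov basis is a set $B\subseteq\ker(A)$ whose binomials $x^{u^+}-x^{u^-}$ generate the toric ideal $I_A=\langle x^{u^+}-x^{u^-}:u\in\ker(A)\rangle$; minimal means no proper subset is a Markov basis. For nonzero $z\in\ker(A)$, $u\in\ker(A)$ reduces the distance of $z$ if there exist $(p,q)\in\{(z^+,z^-),(z^-,z^+)\}$ and $\varepsilon\in\{\pm1\}$ with $p+\varepsilon u\in\mathbb N^n$ and $\|p+\varepsilon u-q\|<\|z\|$; $B$ reduces the distance of $Z$ if each nonzero $z\in Z$ has its distance reduced by some element of $B$; $B$ is distance reducing if it reduces the distance of $\ker(A)$. A circuit is a nonzero element of $\ker(A)$ with support of size exactly two. $A$ admits a gluing of the first kind in the order $(a_1,\dots,a_n)$ if for each $k\in\{1,\dots,n-1\}$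 there is $x\in\mathbb N\{a_1,\dots,a_k\}\cap a_{k+1}\mathbb N$ with $x\mathbb Z=\mathbb Z\{a_1,\dots,a_k\}\cap a_{k+1}\mathbb Z$ (here $\mathbb N X$, $\mathbb ZX$ are the semigroup and group generated by $X$). For $2\le i<j\le n$, $M$ satisfies $R_{i,j}$ if at least one of: (i) $u_{i,1}+\dots+u_{i,i-1}<u_{i,i}$; (ii) there is $\ell\in\{i+1,\dots,j-1\}$ with $u_{\ell,m}=0$ for all $m\in\{1,\dots,\ell-1\}\setminus\{i\}$ and $u_{\ell,i}>u_{\ell,\ell}$; (iii) $\sum_{k=1}^{j}u_{j,k}<2(u_{j,i}+u_{j,j})$. *)

(* Defs.v *)
From HB Require Import structures.
From mathcomp Require Import all_boot all_order all_algebra.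
From mathcomp Require Import mpoly.
Set Implicit Arguments. Unset Strict Implicit. Unset Printing Implicit Defensive.
Import Order.TTheory GRing.Theory Num.Theory.
Local Open Scope ring_scope.

(* Indices are 0-based: paper index k corresponds to the ordinal k-1 : 'I_n.
   Vectors of Z^n are functions 'I_n -> int. *)

Definition vec n := 'I_n -> int.

Definition posp n (z : vec n) : vec n := fun i => Num.max (z i) 0.
Definition negp n (z : vec n) : vec n := fun i => Num.max (- z i) 0.

Definition norm1 n (z : vec n) : int := \sum_(i < n) `|z i|.

Definition inKer n (a : 'I_n -> nat) (z : vec n) : Prop :=
  \sum_(i < n) (a i)%:Z * z i = 0.

Definition mpos n (z : vec n) : 'X_{1..n} := [multinom absz (posp z i) | i < n].
Definition mneg n (z : vec n) : 'X_{1..n} := [multinom absz (negp z i) | i < n].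

Definition binom (K : fieldType) n (z : vec n) : {mpoly K[n]} :=
  'X_[mpos z] - 'X_[mneg z].

Definition gen_ideal (K : fieldType) n (S : {mpoly K[n]} -> Prop)
  (p : {mpoly K[n]}) : Prop :=
  exists s : seq ({mpoly K[n]} * {mpoly K[n]}),
    (forall x, x \in s -> S x.2) /\ p = \sum_(x <- s) x.1 * x.2.

Definition binoms (K : fieldType) n (B : vec n -> Prop) : {mpoly K[n]} -> Prop :=
  fun f => exists u, B u /\ f = @binom K n u.

Definition MarkovBasis (K : fieldType) n (a : 'I_n -> nat) (B : vec n -> Prop) : Prop :=
  (forall u, B u -> inKer a u) /\
  (forall p, @gen_ideal K n (@binoms K n B) p <-> @gen_ideal K n (@binoms K n (inKer a)) p).

Definition minimal_MarkovBasis (K : fieldType) n (a : 'I_n -> nat) (B : vec n -> Prop) : Prop :=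
  @MarkovBasis K n a B /\
  (forall B' : vec n -> Prop, (forall u, B' u -> B u) -> @MarkovBasis K n a B' ->
     forall u, B u -> B' u).

Definition reduces n (u z : vec n) : Prop :=
  exists (b : bool) (e : int), (e = 1 \/ e = -1) /\
    let p := if b then posp z else negp z in
    let q := if b then negp z else posp z in
    (forall i, 0 <= p i + e * u i) /\
    norm1 (fun i => p i + e * u i - q i) < norm1 z.

Definition reduces_set n (B Z : vec n -> Prop) : Prop :=
  forall z, Z z -> z <> (fun _ => 0) -> exists2 u, B u & reduces u z.

Definition distance_reducing n (a : 'I_n -> nat) (B : vec n -> Prop) : Prop :=
  reduces_set B (inKer a).

Definition circuit n (a : 'I_n -> nat) (z : vec n) : Prop :=
  inKer a z /\ #|[pred i | z i != 0]| = 2%N.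

(* ---- gluing of the first kind in the order (a_1,...,a_n) ----
   for each paper index k in 1..n-1, i.e. ordinal k' = k (0-based index of a_{k+1}),
   there is x in N{a_1..a_k} ∩ a_{k+1}N with xZ = Z{a_1..a_k} ∩ a_{k+1}Z. *)
Definition gluing_first_kind n (a : 'I_n -> nat) : Prop :=
  forall k : 'I_n, (0 < k)%N ->
    exists x : nat,
      (exists l : 'I_n -> nat, x = (\sum_(i < n | (i < k)%N) l i * a i)%N) /\
      (exists t : nat, x = (a k * t)%N) /\
      (forall y : int,
         (exists t : int, y = x%:Z * t) <->
         ((exists m : 'I_n -> int, y = \sum_(i < n | (i < k)%N) m i * (a i)%:Z) /\
          (exists t : int, y = (a k)%:Z * t))).

(* ---- the vectors u_k built from the non-negative entries c k m = u_{k,m} ----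
   u_k = (u_{k,1},...,u_{k,k-1}, -u_{k,k}, 0, ..., 0) *)
Definition uvec n (c : 'I_n -> 'I_n -> nat) (k : 'I_n) : vec n :=
  fun m => if (m < k)%N then (c k m)%:Z
           else if m == k then - (c k k)%:Z else 0.

Definition Mset n (c : 'I_n -> 'I_n -> nat) : vec n -> Prop :=
  fun v => exists2 k : 'I_n, (0 < k)%N & v = uvec c k.

Definition R_cond n (c : 'I_n -> 'I_n -> nat) (i j : 'I_n) : Prop :=
  (\sum_(m < n | (m < i)%N) c i m < c i i)%N
  \/ (exists l : 'I_n, [/\ (i < l)%N, (l < j)%N,
        (forall m : 'I_n, (m < l)%N -> m != i -> c l m = 0%N)
        & (c l l < c l i)%N])
  \/ (\sum_(m < n | (m <= j)%N) c j m < 2 * (c j i + c j j))%N.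

(* Main.v *)
(** Since the binomials of [M] generate the toric ideal, [M] spans [ker A] over
    the integers, so every kernel vector is [z = sum_k x_k u_k].

    (3) => (1): let [j] be the last index with [x_j != 0]; up to sign [x_j > 0],
    so [u_j] may be added to [z^-].  Let [k < j] be the last index with
    [x_k < 0], or the first index if there is none.  As [x_m >= 0] for [m > k],
    the coordinate [z_k] is at least each of the terms [x_m u_{m,k}].  If clause
    (i) of [R_{k,j}] holds, then [u_k] reduces [z]; if clause (iii) holds, then
    [u_j] does; if clause (ii) holds and [x_l > 0], then [u_l] does.  If
    [x_l = 0] in clause (ii), repeat the argument at [l]: clause (i) fails
    there, so the search climbs and must end.  The first index needs no
    hypothesis because [a_1 < a_2] makes [u_2] such a vector [u_l].

    (2) => (3): if [u_k] reduces a circuit supported on [{i, j}], the triangle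
    inequality gives [|u_k| < 2 (|u_{k,i}| + |u_{k,j}|)].  For [k <= j] this is
    [R_{i,j}].  If [k > j], then [u_k] climbs from [i] or from [j] to [k], and
    [R_{j,k}] respectively [R_{i,k}], known by descending induction on [j],
    gives [R_{i,j}] or a shorter climb of the same kind. *)

Require Import Defs.
From HB Require Import structures.
From mathcomp Require Import all_boot all_order all_algebra.
From mathcomp Require Import boolp freeg mpoly zify.
Set Implicit Arguments.
Unset Strict Implicit.
Unset Printing Implicit Defensive.
Import Order.TTheory GRing.Theory Num.Theory.
Local Open Scope ring_scope.

Section MonomialFunctional.
Variables (R : nzRingType) (n : nat) (F : 'X_{1..n} -> R).

Definition monomial_functional (p : {mpoly R[n]}) : R :=
  fglift (F : _ -> R^o) p.

Fact monomial_functional_is_zmod_morphism : zmod_morphism monomial_functional.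
Proof. by move=> p q; apply: (lift_is_additive (F : _ -> R^o)). Qed.

HB.instance Definition _ := GRing.isZmodMorphism.Build {mpoly R[n]} R
  monomial_functional monomial_functional_is_zmod_morphism.

Lemma monomial_functionalZX k m : monomial_functional (k *: 'X_[m]) = k * F m.
Proof. by rewrite -MPolyU; apply: (liftU (F : _ -> R^o)). Qed.

Lemma monomial_functionalZB k m1 m2 :
  monomial_functional (k *: ('X_[m1] - 'X_[m2])) = k * (F m1 - F m2).
Proof. by rewrite scalerBr raddfB /= !monomial_functionalZX mulrBr. Qed.

End MonomialFunctional.

Lemma monomial_functional_gen_ideal (K : fieldType) n (F : 'X_{1..n} -> K)
    (B : vec n -> Prop) (p : {mpoly K[n]}) :
  (forall m u, B u -> F (m + mpos u)%MM = F (m + mneg u)%MM) ->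
  gen_ideal (binoms B) p -> monomial_functional F p = 0.
Proof.
move=> F_invariant [s [sB ->]].
rewrite raddf_sum big_seq big1 // => x /sB [u [Bu ->]].
rewrite [x.1]mpolyE mulr_suml raddf_sum big1 //= => m _.
rewrite /binom -scalerAl mulrBr -!mpolyXD monomial_functionalZB.
by rewrite F_invariant // subrr mulr0.
Qed.

Inductive zspan n (B : vec n -> Prop) : vec n -> Prop :=
| zspan_gen u of B u : zspan B u
| zspan0 : zspan B (fun=> 0)
| zspanB z w of zspan B z & zspan B w : zspan B (fun i => z i - w i).

Lemma mpos_sub_mneg n (z : vec n) i : (mpos z i)%:Z - (mneg z i)%:Z = z i.
Proof. by rewrite !mnmE /posp /negp; lia. Qed.

Lemma zspanD n (B : vec n -> Prop) (z w : vec n) :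
  zspan B z -> zspan B w -> zspan B (fun i => z i + w i).
Proof.
move=> Bz Bw; have := zspanB Bz (zspanB (zspan0 B) Bw).
by congr (zspan B); apply/funext => i; rewrite sub0r opprK.
Qed.

(* Modulo the lattice spanned by [B], both monomials of each binomial of [B] lie
   in the same class, so the coefficients of an element of the ideal sum to zero
   over every class of monomials. *)
Lemma binom_gen_ideal_zspan (K : fieldType) n (B : vec n -> Prop) (z : vec n) :
  gen_ideal (binoms B) (binom K z) -> zspan B z.
Proof.
pose same_class m := zspan B (fun i => (m i)%:Z - (mneg z i)%:Z).
pose F (m : 'X_{1..n}) : K := `[< same_class m >]%:R.
have F_invariant m u : B u -> F (m + mpos u)%MM = F (m + mneg u)%MM.
  move=> /zspan_gen Bu; congr (nat_of_bool _)%:R; apply: asbool_equiv_eq.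
  have uE i := mpos_sub_mneg u i.
  split=> [/zspanB/(_ Bu)|/zspanD/(_ Bu)]; congr (zspan B); apply/funext => i;
    by rewrite !mnmDE -(uE i) !PoszD; lia.
move=> /(monomial_functional_gen_ideal F_invariant).
rewrite /binom -[X in monomial_functional _ X]scale1r.
rewrite monomial_functionalZB mul1r.
rewrite [F (mneg z)](_ : _ = 1) /F; last first.
  rewrite asboolT // /same_class (_ : (fun i => _) = fun=> 0).
    exact: zspan0.
  by apply/funext => i; rewrite subrr.
case: asboolP => [zB _|_ /eqP]; last by rewrite sub0r oppr_eq0 oner_eq0.
by move: zB; congr (zspan B); apply/funext => i; rewrite mpos_sub_mneg.
Qed.

Lemma MarkovBasis_zspan (K : fieldType) n (a : 'I_n -> nat) (B : vec n -> Prop)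
    (z : vec n) :
  MarkovBasis K a B -> inKer a z -> zspan B z.
Proof.
move=> [_ idealE] az; apply: (@binom_gen_ideal_zspan K); apply/idealE.
exists [:: (1, binom K z)]; split; last by rewrite big_seq1 mul1r.
by move=> x; rewrite inE => /eqP ->; exists z.
Qed.

Lemma norm1N n (z : vec n) : norm1 (fun i => - z i) = norm1 z.
Proof. by apply: eq_bigr => i _; rewrite normrN. Qed.

Lemma norm1Msign n (b : bool) (z : vec n) :
  norm1 (fun i => (-1) ^+ b * z i) = norm1 z.
Proof. by apply: eq_bigr => i _; rewrite normrMsign. Qed.

Lemma norm1D_lt n (z v : vec n) (S : pred 'I_n) :
  (forall i, S i -> `|z i + v i| = `|z i| - `|v i|) ->
  norm1 v < (\sum_(i | S i) `|v i|) *+ 2 ->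
  norm1 (fun i => z i + v i) < norm1 z.
Proof.
move=> cancelS.
suff : norm1 (fun i => z i + v i) + (\sum_(i | S i) `|v i|) *+ 2
    <= norm1 z + norm1 v.
  by lia.
rewrite /norm1 -sumrMnl [X in _ + X <= _]big_mkcond -!big_split /=.
by apply: ler_sum => i _; case: ifP => [/cancelS ->|_]; lia.
Qed.

Lemma norm1D_lt_support n (z v : vec n) (S : pred 'I_n) :
  (forall i, ~~ S i -> z i = 0) ->
  norm1 (fun i => z i + v i) < norm1 z ->
  norm1 v < (\sum_(i | S i) `|v i|) *+ 2.
Proof.
move=> zS.
suff : norm1 z + norm1 v
    <= norm1 (fun i => z i + v i) + (\sum_(i | S i) `|v i|) *+ 2.
  by lia.
rewrite /norm1 -sumrMnl [X in _ <= _ + X]big_mkcond -!big_split /=.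
by apply: ler_sum => i _; case: ifP => [_|/negbT/zS ->]; lia.
Qed.

Lemma sumr_pred2 (V : nmodType) (I : finType) (i j : I) (F : I -> V) :
  i != j -> \sum_(k | pred2 i j k) F k = F i + F j.
Proof.
move=> ij; rewrite (bigD1 i) /= ?eqxx // (big_pred1 j) // => k.
by case: eqVneq => [->|_]; rewrite /= ?(negPf ij) ?andbT.
Qed.

Lemma posp_ge0 n (z : vec n) i : 0 <= posp z i.
Proof. by rewrite /posp; lia. Qed.

Lemma negp_ge0 n (z : vec n) i : 0 <= negp z i.
Proof. by rewrite /negp; lia. Qed.

(* Moving [z^+] by [v] and moving [z^-] by [-v] both turn [z^+ - z^-] into
   [z + v]. *)
Definition admissible n (z v : vec n) : Prop :=
  (forall i, 0 <= posp z i + v i) \/ (forall i, 0 <= negp z i - v i).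

Lemma reducesP n (u z : vec n) :
  reduces u z <->
  exists b : bool, let v := fun i => (-1) ^+ b * u i in
    admissible z v /\ norm1 (fun i => z i + v i) < norm1 z.
Proof.
have posE e : norm1 (fun i => posp z i + e * u i - negp z i) =
    norm1 (fun i => z i + e * u i).
  by apply: eq_bigr => i _; congr `|_|; rewrite /posp /negp; lia.
have negE e : norm1 (fun i => negp z i + e * u i - posp z i) =
    norm1 (fun i => z i - e * u i).
  rewrite -norm1N; apply: eq_bigr => i _; congr `|_|.
  by rewrite /posp /negp; lia.
split=> [[p [e [e1 [ge0 lt_z]]]]|[b [[ge0|ge0] lt_z]]].
- have [b eE] : exists b : bool, e = (-1) ^+ b.
    by case: e1 => ->; [exists false | exists true].
  rewrite {}eE {e e1} in ge0 lt_z; case: p ge0 lt_z => /= ge0.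
    by rewrite posE; exists b; split=> //; left.
  rewrite negE => lt_z; exists (~~ b); rewrite /= signrN; split.
    by right=> i; rewrite mulNr opprK.
  by under eq_fun do rewrite mulNr.
- exists true, ((-1) ^+ b); rewrite /= posE.
  by split; first by case: b {ge0 lt_z}; [right | left].
exists false, (- (-1) ^+ b); rewrite /= negE; split.
  by case: b {ge0 lt_z}; [left; rewrite opprK | right].
split; first by move=> i; rewrite mulNr.
by under eq_fun do rewrite mulNr opprK.
Qed.

Lemma admissible_opp n (z v : vec n) :
  admissible (fun i => - z i) v -> admissible z (fun i => - v i).
Proof.
by case=> ge0; [right | left] => i; move: (ge0 i); rewrite /posp /negp; lia.
Qed.

Lemma reduces_opp n (u z : vec n) : reduces u (fun i => - z i) -> reduces u z.
Proof.
case/reducesP=> b [/admissible_opp adm lt_z].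
apply/reducesP; exists (~~ b); rewrite /= signrN.
under [X in norm1 X]eq_fun do rewrite mulNr; split.
  by move: adm; congr (admissible z); apply/funext => i; rewrite mulNr.
rewrite norm1N -norm1N in lt_z.
by under eq_fun do rewrite -[z _]opprK -opprD.
Qed.

Lemma admissible_cancel_reduces n (u z : vec n) (b : bool) (S : pred 'I_n) :
  let v := fun i => (-1) ^+ b * u i in
  admissible z v ->
  (forall i, S i -> `|z i + v i| = `|z i| - `|u i|) ->
  norm1 u < (\sum_(i | S i) `|u i|) *+ 2 ->
  reduces u z.
Proof.
move=> v adm cancelS lt_u; apply/reducesP; exists b; split=> //.
apply: (@norm1D_lt _ _ _ S) => [i /cancelS|]; first by rewrite normrMsign.
rewrite norm1Msign.
by under eq_bigr do rewrite normrMsign.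
Qed.

Lemma reduces_lt_support n (u z : vec n) (S : pred 'I_n) :
  (forall i, ~~ S i -> z i = 0) -> reduces u z ->
  norm1 u < (\sum_(i | S i) `|u i|) *+ 2.
Proof.
move=> zS /reducesP [b [_ /(norm1D_lt_support zS)]]; rewrite norm1Msign.
by under eq_bigr do rewrite normrMsign.
Qed.

Section Triangular.
Variables (n : nat) (c : 'I_n -> 'I_n -> nat).
Implicit Types i j k l m s : 'I_n.
Implicit Types (x : 'I_n -> int) (z p : vec n).

Local Notation u := (uvec c).

Definition contracting i : Prop := (\sum_(m < n | (m < i)%N) c i m < c i i)%N.

Definition supported_below s l : bool :=
  [forall m : 'I_n, ((m < l)%N && (m != s)) ==> (c l m == 0%N)].

(* Clause (ii): [u l] trades [c l i] units at [i] for fewer units at [l]. *)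
Definition climbs i l : bool :=
  [&& (i < l)%N, supported_below i l & (c l l < c l i)%N].

Definition dominant i j : Prop :=
  (\sum_(m < n | (m <= j)%N) c j m < 2 * (c j i + c j j))%N.

Definition transferable i j : Prop :=
  (exists2 l, climbs i l & (l < j)%N) \/ dominant i j.

Lemma supported_belowP s l :
  reflect (forall m, (m < l)%N -> m != s -> c l m = 0%N) (supported_below s l).
Proof.
apply: (iffP 'forall_implyP) => [h m ml ms|h m /andP [ml ms]].
  by apply/eqP/h; rewrite ml.
by rewrite h.
Qed.

Lemma R_condP i j : R_cond c i j <-> contracting i \/ transferable i j.
Proof.
split.
  case=> [|[[l [il lj cl0 cl]]|]]; [by left| |by right; right].
  right; left; exists l => //; apply/and3P; split=> //.
  exact/supported_belowP.
case=> [|[[l /and3P [il /supported_belowP cl0 cl] lj]|]]; [by left| |].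
  by right; left; exists l.
by right; right.
Qed.

Lemma uvec_lt k m : (m < k)%N -> u k m = (c k m)%:Z.
Proof. by rewrite /uvec => ->. Qed.

Lemma uvec_diag k : u k k = - (c k k)%:Z.
Proof. by rewrite /uvec ltnn eqxx. Qed.

Lemma uvec_gt k m : (k < m)%N -> u k m = 0.
Proof.
by move=> km; rewrite /uvec ltnNge (ltnW km) /= ifN // neq_ltn km orbT.
Qed.

Lemma abs_uvec k m : `|u k m| = (if (m <= k)%N then c k m else 0%N)%:Z.
Proof.
case: ltngtP => [mk|km|/val_inj ->].
- by rewrite uvec_lt.
- by rewrite uvec_gt ?normr0.
by rewrite uvec_diag normrN.
Qed.

Lemma norm1_uvec k : norm1 (u k) = (\sum_(m < n | (m <= k)%N) c k m)%N%:Z.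
Proof.
rewrite (big_morph Posz PoszD (erefl _)) big_mkcond /norm1.
by apply: eq_bigr => m _; rewrite abs_uvec; case: ifP.
Qed.

Lemma row_sum_leq k : (\sum_(m < n | (m <= k)%N) c k m =
  \sum_(m < n | (m < k)%N) c k m + c k k)%N.
Proof.
rewrite (bigD1 k) //= addnC; congr addn; apply: eq_bigl => m.
by rewrite ltn_neqAle andbC.
Qed.

Lemma row_sum_supported_below s l : (s < l)%N -> supported_below s l ->
  (\sum_(m < n | (m < l)%N) c l m = c l s)%N.
Proof.
move=> sl /supported_belowP cl0; rewrite (bigD1 s) //= big1 ?addn0 // => m.
by case/andP; apply: cl0.
Qed.

Lemma climbs_row_sum i l : climbs i l ->
  (\sum_(m < n | (m <= l)%N) c l m = c l i + c l l)%N.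
Proof.
case/and3P=> il supp _.
by rewrite row_sum_leq (row_sum_supported_below il supp).
Qed.

Lemma climbs_not_contracting i l : climbs i l -> ~ contracting l.
Proof.
case/and3P=> il supp cl; rewrite /contracting (row_sum_supported_below il supp).
by lia.
Qed.

Lemma climbs_dominant i j : (0 < c j j)%N -> climbs i j -> dominant i j.
Proof. by move=> cj /climbs_row_sum; rewrite /dominant; lia. Qed.

Lemma climbs_not_dominant i s k :
  (s < k)%N -> s != i -> climbs i k -> ~ dominant s k.
Proof.
move=> sk si cik; have [_ /supported_belowP/(_ s sk si) cks0 ck] := and3P cik.
by rewrite /dominant (climbs_row_sum cik) cks0; lia.
Qed.

Lemma contracting_dominant i j : contracting j -> dominant i j.
Proof. by rewrite /contracting /dominant row_sum_leq; lia. Qed.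

Lemma uvec_add_ge0 p k : (forall m, 0 <= p m) -> (c k k)%:Z <= p k ->
  forall m, 0 <= p m + u k m.
Proof.
move=> p_ge0 pk m; have pm := p_ge0 m.
case: (ltngtP m k) => [mk|km|/val_inj ->].
- by rewrite uvec_lt //; lia.
- by rewrite uvec_gt // addr0.
by rewrite uvec_diag; lia.
Qed.

Lemma contracting_reduces z i :
  contracting i -> (c i i)%:Z <= z i -> reduces (u i) z.
Proof.
move=> ci zi; apply: (@admissible_cancel_reduces _ _ _ false (pred1 i)).
- left=> m; rewrite mul1r; apply: uvec_add_ge0 => [?|]; first exact: posp_ge0.
  by rewrite /posp; lia.
- by move=> m /eqP ->; rewrite mul1r uvec_diag; lia.
rewrite (big_pred1 i) // norm1_uvec row_sum_leq uvec_diag.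
by rewrite /contracting in ci; lia.
Qed.

Lemma climbs_reduces z i l : climbs i l -> (c l i)%:Z <= z i -> reduces (u l) z.
Proof.
move=> cil zi; have [il /supported_belowP cl0 cl] := and3P cil.
apply: (@admissible_cancel_reduces _ _ _ true (pred1 i)).
- left=> m; rewrite mulN1r; have zm := posp_ge0 z m.
  case: (ltngtP m l) => [ml|lm|/val_inj ->].
  + have [->|mi] := eqVneq m i; first by rewrite uvec_lt // /posp; lia.
    by rewrite uvec_lt // cl0 // subr0.
  + by rewrite uvec_gt // subr0.
  + by rewrite uvec_diag opprK addr_ge0 // posp_ge0.
- by move=> m /eqP ->; rewrite mulN1r uvec_lt //; lia.
by rewrite (big_pred1 i) // norm1_uvec (climbs_row_sum cil) uvec_lt //; lia.
Qed.

Lemma dominant_reduces z i j : (i < j)%N -> dominant i j ->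
  (c j i)%:Z <= z i -> z j <= - (c j j)%:Z -> reduces (u j) z.
Proof.
move=> ij dij zi zj.
apply: (@admissible_cancel_reduces _ _ _ true (pred2 i j)).
- right=> m; rewrite mulN1r opprK; apply: uvec_add_ge0 => [?|].
    exact: negp_ge0.
  by rewrite /negp; lia.
- move=> m /orP [] /eqP ->; rewrite mulN1r; first by rewrite uvec_lt //; lia.
  by rewrite uvec_diag; lia.
rewrite sumr_pred2 ?neq_ltn ?ij // norm1_uvec uvec_lt // uvec_diag.
by rewrite /dominant in dij; lia.
Qed.

Definition combination x : vec n := fun m => \sum_k x k * u k m.

Definition nonneg_above x i : Prop := forall m, (i < m)%N -> 0 <= x m.

Definition zero_above x j : Prop := forall m, (j < m)%N -> x m = 0.

(* The first index carries no vector of [Mset c]. *)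
Definition zero_first x : Prop := forall k, val k = 0%N -> x k = 0.

Lemma combinationN x :
  combination (fun k => - x k) = fun m => - combination x m.
Proof.
by apply/funext => m; rewrite -sumrN; apply: eq_bigr => k _; rewrite mulNr.
Qed.

Lemma zspan_Mset z : zspan (Mset c) z ->
  exists2 x, zero_first x & z = combination x.
Proof.
elim=> [_ [k k_gt0 ->]||v w _ [x x0 ->] _ [y y0 ->]].
- exists (fun l => (l == k)%:R) => [l l0|].
    by case: eqP k_gt0 => // <-; rewrite l0.
  apply/funext => m; rewrite /combination (bigD1 k) //= eqxx mul1r.
  by rewrite big1 ?addr0 // => l /negPf ->; rewrite mul0r.
- exists (fun=> 0) => //; apply/funext => m.
  by rewrite /combination big1 // => k _; rewrite mul0r.
exists (fun k => x k - y k) => [k k0|]; first by rewrite x0 ?y0.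
apply/funext => m; rewrite /combination -sumrB.
by apply: eq_bigr => k _; rewrite mulrBl.
Qed.

Lemma combination_ge_term x i l : x i <= 0 -> nonneg_above x i ->
  x l * u l i <= combination x i.
Proof.
move=> xi x_ge0; rewrite /combination (bigD1 l) //= lerDl sumr_ge0 // => k _.
case: (ltngtP k i) => [ki|ik|/val_inj ->].
- by rewrite uvec_gt // mulr0.
- by rewrite uvec_lt // mulr_ge0 // x_ge0.
by rewrite uvec_diag mulrN -mulNr mulr_ge0 // oppr_ge0.
Qed.

Lemma combination_lead x j : zero_above x j ->
  combination x j = - (x j * (c j j)%:Z).
Proof.
move=> x0; rewrite /combination (bigD1 j) //= uvec_diag mulrN.
rewrite big1 ?addr0 // => k kj.
case: (ltngtP k j) => [kj'|jk|/val_inj E]; last by rewrite E eqxx in kj.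
  by rewrite uvec_gt // mulr0.
by rewrite x0 // mul0r.
Qed.

Section Reduction.
Hypothesis R_cond_all : forall i j, (0 < i)%N -> (i < j)%N -> R_cond c i j.
Hypothesis transferable_first :
  forall i j, val i = 0%N -> (0 < j)%N -> transferable i j.

(* Either the climbing vector [u l] occurs in [x] and can be subtracted, or
   [x l = 0] and the search moves up to [l], which is not contracting. *)
Lemma transferable_reduces x i j :
  (i < j)%N -> 0 < x j -> zero_above x j -> x i <= 0 -> nonneg_above x i ->
  transferable i j -> exists2 v, Mset c v & reduces v (combination x).
Proof.
move=> ij xj xj0; have [d] := ubnP (j - i)%N.
elim: d i ij => // d IHd i ij le_d xi x_ge0 [[l cil lj]|dij]; last first.
  exists (u j); first by exists j => //; lia.
  apply: dominant_reduces dij _ _ => //.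
    by have := combination_ge_term j xi x_ge0; rewrite uvec_lt //; nia.
  by rewrite combination_lead //; nia.
have [il _ _] := and3P cil.
have [xl|xl] := lerP (x l) 0; last first.
  exists (u l); first by exists l => //; lia.
  apply: climbs_reduces cil _.
  by have := combination_ge_term l xi x_ge0; rewrite uvec_lt //; nia.
apply: (IHd l) => //; first by lia.
  by move=> m lm; apply: x_ge0; lia.
have /R_condP [/(climbs_not_contracting cil)//|//] : R_cond c l j.
by apply: R_cond_all; lia.
Qed.

Lemma positive_lead_reduces x j :
  zero_first x -> 0 < x j -> zero_above x j ->
  exists2 v, Mset c v & reduces v (combination x).
Proof.
move=> x0 xj xj0.
have j_gt0 : (0 < j)%N.
  by rewrite lt0n; apply/eqP => /x0 xj_eq0; rewrite xj_eq0 ltxx in xj.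
pose first : 'I_n := Ordinal (leq_ltn_trans (leq0n j) (ltn_ord j)).
pose stop k := (val k == 0%N) || (x k < 0).
have [k stop_k k_max] := @arg_maxnP _ first stop (fun k => val k) isT.
have x_ge0 : nonneg_above x k.
  move=> m km; rewrite leNgt; apply: contraL km => xm.
  by rewrite -leqNgt; apply: k_max; rewrite /stop xm orbT.
have xk : x k <= 0 by case/orP: stop_k => [/eqP/x0 ->|/ltW].
have kj : (k < j)%N.
  case/orP: stop_k => [/eqP -> //|xk_lt0].
  case: (ltngtP k j) => [//|/xj0|/val_inj kj]; first by lia.
  by move: xk_lt0; rewrite kj; lia.
have transfer := transferable_reduces kj xj xj0 xk x_ge0.
have [/transferable_first/(_ j_gt0)//|k_gt0] := posnP k.
have xk_lt0 : x k < 0 by move: stop_k; rewrite /stop eqn0Ngt k_gt0.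
have /R_condP [ck|//] := R_cond_all k_gt0 kj.
exists (u k); first by exists k.
apply: contracting_reduces ck _.
by have := combination_ge_term k xk x_ge0; rewrite uvec_diag; nia.
Qed.

Lemma nonzero_combination_reduces x : zero_first x ->
  combination x <> (fun=> 0) -> exists2 v, Mset c v & reduces v (combination x).
Proof.
move=> x0 z_neq0.
have [j0 xj0] : exists j, x j != 0.
  apply/existsP; apply: contra_notT z_neq0 => /existsPn x_eq0.
  apply/funext => m; apply: big1 => k _.
  by have /negbNE/eqP -> := x_eq0 k; rewrite mul0r.
have [j xj j_max] := @arg_maxnP _ j0 (fun k => x k != 0) (fun k => val k) xj0.
have xj_above : zero_above x j.
  by move=> m jm; apply/eqP; apply: contraLR jm => /j_max; rewrite -leqNgt.
case: (ltrgtP (x j) 0) => [xj_lt0|xj_gt0|xj_eq0]; last first.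
- by rewrite xj_eq0 eqxx in xj.
- exact: positive_lead_reduces xj_above.
have [] := @positive_lead_reduces (fun k => - x k) j.
- by move=> k /x0 ->; rewrite oppr0.
- by rewrite oppr_gt0.
- by move=> m /xj_above ->; rewrite oppr0.
by move=> v Mv; rewrite combinationN => /reduces_opp; exists v.
Qed.

End Reduction.

Lemma supported_add_supported_below p s k (b : bool) :
  (0 < c k k)%N -> s != k -> (forall m, m != s -> p m = 0) ->
  (forall m, 0 <= p m + (-1) ^+ b * u k m) -> supported_below s k.
Proof.
move=> ck sk p0 ge0; apply/supported_belowP => m mk ms.
have b_true : b.
  move: (ge0 k); rewrite p0 1?eq_sym // uvec_diag.
  by case: b {ge0}; rewrite // mul1r; lia.
by move: (ge0 m); rewrite b_true mulN1r p0 // uvec_lt //; lia.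
Qed.

Lemma supported_below_climbs s s' k :
  (0 < c k k)%N -> s != k -> s' != k -> s' != s -> supported_below s k ->
  norm1 (u k) < (`|u k s| + `|u k s'|) *+ 2 -> climbs s k.
Proof.
move=> ck sk s'k s's supp lt_u.
have us' : u k s' = 0.
  case: (ltngtP s' k) => [lt|gt|/val_inj E]; last by rewrite E eqxx in s'k.
    by rewrite uvec_lt // (supported_belowP _ _ supp).
  exact: uvec_gt.
move: lt_u; rewrite us' normr0 addr0 norm1_uvec.
case: (ltngtP s k) => [lt|gt|/val_inj E]; last by rewrite E eqxx in sk.
  rewrite row_sum_leq (row_sum_supported_below lt supp) uvec_lt // => lt_u.
  by apply/and3P; split=> //; lia.
by rewrite uvec_gt //; lia.
Qed.

Section SingletonSupports.
Variables (z : vec n) (i j k : 'I_n).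
Hypotheses (ij : (i < j)%N) (ck : (0 < c k k)%N).
Hypotheses (posp_z : forall m, m != i -> posp z m = 0)
  (negp_z : forall m, m != j -> negp z m = 0).

Lemma reduces_norm1_lt : reduces (u k) z ->
  norm1 (u k) < (`|u k i| + `|u k j|) *+ 2.
Proof.
move=> red; rewrite -(sumr_pred2 (fun m => `|u k m|)) ?neq_ltn ?ij //.
apply: reduces_lt_support red => m.
by rewrite negb_or => /andP [/posp_z + /negp_z]; rewrite /posp /negp; lia.
Qed.

Lemma reduces_climbs : k != i -> k != j -> reduces (u k) z ->
  climbs i k \/ climbs j k.
Proof.
move=> ki kj red; have lt_u := reduces_norm1_lt red.
have ji : j != i by rewrite neq_ltn ij orbT.
have [ik jk] : i != k /\ j != k by rewrite ![_ == k]eq_sym.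
have [b [[ge0|ge0] _]] := (reducesP _ _).1 red; [left|right].
  apply: (supported_below_climbs ck ik jk ji _ lt_u).
  exact: supported_add_supported_below ck ik posp_z ge0.
have supp : supported_below j k.
  apply: (supported_add_supported_below (b := ~~ b) ck jk negp_z).
  by move=> m; rewrite signrN mulNr.
rewrite addrC in lt_u.
by apply: supported_below_climbs supp lt_u; rewrite // eq_sym.
Qed.

Lemma reduces_R_cond_or_climbs : reduces (u k) z ->
  R_cond c i j \/ (j < k)%N /\ (climbs i k \/ climbs j k).
Proof.
move=> red; have := reduces_norm1_lt red; rewrite norm1_uvec !abs_uvec => lt_u.
have [k_eq_i|ki] := eqVneq k i.
  left; apply/R_condP; left; move: lt_u.
  by rewrite k_eq_i row_sum_leq leqnn (ltn_geF ij) /contracting; lia.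
have [k_eq_j|kj] := eqVneq k j.
  left; apply/R_condP; right; right; move: lt_u.
  by rewrite k_eq_j leqnn (ltnW ij) /dominant; lia.
have := reduces_climbs ki kj red.
case: (ltngtP k j) => [lt_kj|jk climbs_k|/val_inj E].
- case=> [cik|/and3P [jk _ _]]; last by lia.
  by left; apply/R_condP; right; left; exists k.
- by right.
by rewrite E eqxx in kj.
Qed.

End SingletonSupports.

(* The climb to [k] rules out dominance at [k], so clause (ii) at [k] yields a
   shorter climb, until it lands at or below [j]. *)
Lemma climbs_R_cond i j k :
  (i < j)%N -> (j < k)%N -> (forall l, (0 < l)%N -> (0 < c l l)%N) ->
  (forall s l, (j < l)%N -> (s < l)%N -> R_cond c s l) ->
  climbs i k \/ climbs j k -> R_cond c i j.
Proof.
move=> ij + c_gt0 R_above; have [d] := ubnP k.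
elim: d k => // d IHd k le_d jk.
have [nij nji] : i != j /\ j != i by rewrite !neq_ltn ij orbT.
case=> [cik|cjk].
  have /R_condP [cj|[[l cjl lk]|]] := R_above j k jk jk.
  - by apply/R_condP; right; right; apply: contracting_dominant.
  - by have [jl _ _] := and3P cjl; apply: (IHd l); [lia| |right].
  - by case/(climbs_not_dominant jk nji cik).
have ik := ltn_trans ij jk.
have /R_condP [ci|[[l cil lk]|]] := R_above i k jk ik.
- by apply/R_condP; left.
- apply/R_condP; case: (ltngtP l j) => [lj|jl|/val_inj E].
  + by right; left; exists l.
  + by apply/R_condP; apply: (IHd l); [lia| |left].
  + by right; right; apply: climbs_dominant; rewrite -?E // c_gt0 // E; lia.
by case/(climbs_not_dominant ik nij cjk).
Qed.

End Triangular.

Definition elementary_circuit n (a : 'I_n -> nat) (i j : 'I_n) : vec n :=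
  fun m => if m == i then (a j)%:Z else if m == j then - (a i)%:Z else 0.

Lemma elementary_circuitP n (a : 'I_n -> nat) (i j : 'I_n) :
  i != j -> (0 < a i)%N -> (0 < a j)%N -> circuit a (elementary_circuit a i j).
Proof.
rewrite /elementary_circuit => ij ai aj; split.
  rewrite /inKer (bigD1 i) //= (bigD1 j) 1?eq_sym //=.
  rewrite big1 => [|m /andP [mi mj]].
    by rewrite [j == i]eq_sym (negPf ij) !eqxx; lia.
  by rewrite (negPf mi) (negPf mj) mulr0.
transitivity #|pred2 i j|; last by rewrite card2 ij.
apply: eq_card => m; rewrite !inE.
have [_|_] := eqVneq m i; first by rewrite /=; lia.
by have [_|_] := eqVneq m j; rewrite /= ?eqxx //; lia.
Qed.

Lemma posp_elementary_circuit n (a : 'I_n -> nat) (i j m : 'I_n) :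
  m != i -> posp (elementary_circuit a i j) m = 0.
Proof.
by rewrite /posp /elementary_circuit => /negPf ->; case: ifP => _; lia.
Qed.

Lemma negp_elementary_circuit n (a : 'I_n -> nat) (i j m : 'I_n) :
  m != j -> negp (elementary_circuit a i j) m = 0.
Proof.
by rewrite /negp /elementary_circuit => /negPf ->; case: ifP => _; lia.
Qed.

Section PositiveDiagonal.
Variables (n : nat) (a : 'I_n -> nat) (c : 'I_n -> 'I_n -> nat).
Hypothesis c_gt0 : forall k : 'I_n, (0 < k)%N -> (0 < c k k)%N.

Lemma reduces_circuits_R_cond :
  (forall i, (0 < a i)%N) -> reduces_set (Mset c) (circuit a) ->
  forall i j : 'I_n, (i < j)%N -> R_cond c i j.
Proof.
move=> a_gt0 red i j; have [d] := ubnP (n - j)%N.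
elim: d i j => // d IHd i j le_d ij.
have nij : i != j by rewrite neq_ltn ij.
have [||_ [k k_gt0 ->] red_k] := red (elementary_circuit a i j).
- exact: elementary_circuitP.
- move/(congr1 (fun z => z i)); rewrite /elementary_circuit eqxx.
  by have := a_gt0 j; lia.
have [//|[jk]] := reduces_R_cond_or_climbs ij (c_gt0 k_gt0)
  (@posp_elementary_circuit _ a i j) (@negp_elementary_circuit _ a i j) red_k.
apply: climbs_R_cond => // s l jl sl; apply: IHd => //.
by have := ltn_ord l; lia.
Qed.

Lemma climbs_to_second (i l : 'I_n) :
  val i = 0%N -> val l = 1%N -> (a i < a l)%N -> inKer a (uvec c l) ->
  climbs c i l.
Proof.
move=> i0 l1 ail; have il : (i < l)%N by rewrite i0 l1.
have li : l != i by rewrite neq_ltn il orbT.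
have c_ll : (0 < c l l)%N by apply: c_gt0; rewrite l1.
have below_l (m : 'I_n) : (m < l)%N -> m = i.
  by rewrite l1 ltnS leqn0 => /eqP m0; apply: val_inj; rewrite i0.
rewrite /inKer (bigD1 i) //= (bigD1 l) //= big1 => [|m /andP [mi ml]].
  rewrite uvec_lt // uvec_diag => ker0; apply/and3P; split=> //; last by nia.
  by apply/supported_belowP => m /below_l ->; rewrite eqxx.
case: (ltngtP m l) => [/below_l E|lm|/val_inj E]; last by rewrite E eqxx in ml.
  by rewrite E eqxx in mi.
by rewrite uvec_gt // mulr0.
Qed.

Lemma first_transferable (i l j : 'I_n) : val i = 0%N -> val l = 1%N ->
  climbs c i l -> (0 < j)%N -> transferable c i j.
Proof.
move=> i0 l1 cil j_gt0; case: (ltngtP l j) => [lj|jl|/val_inj <-].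
- by left; exists l.
- by move: jl; rewrite l1; lia.
by right; apply: climbs_dominant cil; apply: c_gt0; rewrite l1.
Qed.

End PositiveDiagonal.

Theorem theorem4p3 (K : fieldType) (n : nat) (a : 'I_n -> nat)
    (c : 'I_n -> 'I_n -> nat) :
  (2 <= n)%N ->
  (forall i, 0 < a i)%N ->
  (forall i j : 'I_n, val i = 0%N -> val j = 1%N -> (a i < a j)%N) ->
  gluing_first_kind a ->
  (forall k : 'I_n, (0 < k)%N -> (0 < c k k)%N) ->
  @minimal_MarkovBasis K n a (Mset c) ->
  (distance_reducing a (Mset c) <-> reduces_set (Mset c) (circuit a)) /\
  (reduces_set (Mset c) (circuit a) <->
     (forall i j : 'I_n, (0 < i)%N -> (i < j)%N -> R_cond c i j)).
Proof.
move=> n_ge2 a_gt0 a01 _ c_gt0 [markov _].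
have dist_circ : distance_reducing a (Mset c) ->
    reduces_set (Mset c) (circuit a).
  by move=> red z [az _]; apply: red.
have circ_R : reduces_set (Mset c) (circuit a) ->
    forall i j : 'I_n, (0 < i)%N -> (i < j)%N -> R_cond c i j.
  by move=> red i j _; apply: reduces_circuits_R_cond a_gt0 red i j.
have R_dist : (forall i j : 'I_n, (0 < i)%N -> (i < j)%N -> R_cond c i j) ->
    distance_reducing a (Mset c).
  move=> R z /(MarkovBasis_zspan markov)/zspan_Mset [x x0 ->].
  apply: nonzero_combination_reduces x0 => // i j i0; pose l := Ordinal n_ge2.
  apply: (@first_transferable _ _ c_gt0 i l) => //.
  apply: (climbs_to_second c_gt0 i0) => //; first exact: a01.
  by case: markov => ker _; apply: ker; exists l.
by split; split=> //; [move/circ_R/R_dist | move/R_dist/dist_circ].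
Qed.
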